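(* The hanging equilibrium $(\Gamma_h,0)=\left(\frac{\rho}{\|\rho\|},0\right)$ of the reduced dynamics of the 3D pendulum on $S^2\times\mathbb{R}^3$ described by $$J\dot\omega=J\omega\times\omega+mg\,\rho\times\Gamma,\qquad \dot\Gamma=\Gamma\times\omega$$ is stable in the sense of Lyapunov.
   Context: $\Gamma=R^Te_3\in S^2$ is the gravity direction in the body-fixed frame ($R\in SO(3)$ the attitude of the rigid body, $e_3=(0,0,1)^T$), $\omega\in\mathbb{R}^3$ the body-fixed angular velocity, $J$ the constant symmetric positive definite inertia matrix (body frame, origin at the pivot), $m>0$ the mass, $g>0$ the gravitational acceleration, $\rho\in\mathbb{R}^3$, $\rho\neq0$, the body-fixed vector from the pivot to the center of mass. *)

(* Defs.v *)
From HB Require Import structures.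
From mathcomp Require Import all_boot all_order all_algebra.
From mathcomp Require Import all_classical all_reals all_analysis.

Set Implicit Arguments.
Unset Strict Implicit.
Unset Printing Implicit Defensive.

Import Order.TTheory GRing.Theory Num.Theory.
Import numFieldNormedType.Exports.

Local Open Scope classical_set_scope.
Local Open Scope ring_scope.

Definition dotprod (R : realType) (u v : 'cV[R]_3) : R := (u^T *m v) 0 0.

(* The norm that the library puts on matrices is the sup norm. *)
Definition enorm (R : realType) (u : 'cV[R]_3) : R := Num.sqrt (dotprod u u).

(* Indices are taken mod 3: (u x v)_i = u_(i+1) v_(i+2) - u_(i+2) v_(i+1). *)
Definition crossprod (R : realType) (u v : 'cV[R]_3) : 'cV[R]_3 :=
  \col_(i < 3) (u (i + 1) 0 * v (i + 2%:R) 0 - u (i + 2%:R) 0 * v (i + 1) 0).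

Definition sphere2 (R : realType) : set 'cV[R]_3 := [set u | enorm u = 1].

Definition symmetric_posdef (R : realType) (J : 'M[R]_3) : Prop :=
  J^T = J /\ forall v : 'cV[R]_3, v != 0 -> 0 < dotprod v (J *m v).

(* An autonomous, possibly implicit, differential equation on V is given by
   a relation E between a state and its velocity. *)

Definition equilibrium (R : realType) (V : normedModType R)
  (X : set V) (E : V -> V -> Prop) (xe : V) : Prop := X xe /\ E xe 0.

(* A forward solution on [0, T[, where T may be +oo. Being continuous up to 0,
   it satisfies the equation with a one-sided derivative at 0 as soon as the
   velocity depends continuously on the state. *)
Definition solution (R : realType) (V : normedModType R)
    (E : V -> V -> Prop) (T : \bar R) (x : R -> V) : Prop :=
  {within [set t : R | 0 <= t /\ (t%:E < T)%E], continuous x} /\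
  forall t : R, 0 < t -> (t%:E < T)%E ->
    derivable x t 1 /\ E (x t) ('D_1 x t).

(* Lyapunov stability of xe for the dynamics on the phase space X, a subset of
   V. Only the initial state is assumed to lie in X; the conclusion includes
   that the trajectory stays in X. The bound is required of every forward
   solution, on whatever interval it is defined. *)
Definition lyapunov_stable (R : realType) (V : normedModType R)
    (X : set V) (E : V -> V -> Prop) (xe : V) : Prop :=
  forall e : R, 0 < e -> exists2 d : R, 0 < d &
    forall (T : \bar R) (x : R -> V), solution E T x ->
      (X `&` ball xe d) (x 0) ->
      forall t : R, 0 <= t -> (t%:E < T)%E -> (X `&` ball xe e) (x t).

(* States are pairs (Gamma, omega). *)
Definition pendulum_phase_space (R : realType) :
    set ('cV[R]_3 * 'cV[R]_3)%type :=
  @sphere2 R `*` setT.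

Definition pendulum_dynamics (R : realType) (J : 'M[R]_3) (m g : R)
    (rho : 'cV[R]_3) (x dx : 'cV[R]_3 * 'cV[R]_3) : Prop :=
  let: (Gamma, omega) := x in
  let: (dGamma, domega) := dx in
  J *m domega = crossprod (J *m omega) omega + (m * g) *: crossprod rho Gamma
  /\ dGamma = crossprod Gamma omega.

Definition hanging_equilibrium (R : realType) (rho : 'cV[R]_3) :
    'cV[R]_3 * 'cV[R]_3 :=
  ((enorm rho)^-1 *: rho, 0).

(* Main.v *)
(* The energy [<w, J w> + m g |rho| |G - rho/|rho||^2] is a first integral, and
   so is [|G|^2]. The energy vanishes at the hanging equilibrium and bounds the
   squares of all coordinates of the deviation from it, because the form of [J]
   is positive definite; continuity of the energy at the equilibrium then gives
   stability. *)
Require Import Defs.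
From mathcomp Require Import all_boot all_order all_algebra.
From mathcomp Require Import all_classical all_reals all_analysis.
From mathcomp Require Import ring.

Set Implicit Arguments.
Unset Strict Implicit.
Unset Printing Implicit Defensive.

Import Order.TTheory GRing.Theory Num.Theory.
Import numFieldNormedType.Exports.
Local Open Scope classical_set_scope.
Local Open Scope ring_scope.

(** * Algebra of the dot and cross products, and of positive definite forms *)

Section DotCross.
Variable R : realType.
Implicit Types (u v w : 'cV[R]_3) (A J : 'M[R]_3).

Lemma dotprodE u v : dotprod u v = \sum_i u i 0 * v i 0.
Proof. by rewrite /dotprod mxE; apply: eq_bigr => i _; rewrite mxE. Qed.

Lemma dotprod3E u v :
  dotprod u v = u 0 0 * v 0 0 + u 1 0 * v 1 0 + u 2%:R 0 * v 2%:R 0.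
Proof.
rewrite dotprodE !big_ord_recl big_ord0 addr0 addrA.
by congr (_ + _ * _ + _ * _); congr (fun_of_matrix _ _ _); apply: val_inj.
Qed.

Lemma crossprod3E u v :
  (crossprod u v 0 0 = u 1 0 * v 2%:R 0 - u 2%:R 0 * v 1 0) *
  (crossprod u v 1 0 = u 2%:R 0 * v 0 0 - u 0 0 * v 2%:R 0) *
  (crossprod u v 2%:R 0 = u 0 0 * v 1 0 - u 1 0 * v 0 0).
Proof.
split; first split; rewrite mxE ?add0r //.
  (* Indices are added modulo 3, so for instance [1 + 2%:R] and [0] agree as ordinals. *)
  by congr (_ * _ - _ * _); congr (fun_of_matrix _ _ _); apply: val_inj.
by congr (_ * _ - _ * _); congr (fun_of_matrix _ _ _); apply: val_inj.
Qed.

Lemma dotprodC u v : dotprod u v = dotprod v u.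
Proof. by rewrite !dotprod3E; ring. Qed.

Lemma dotprodDl u v w : dotprod (u + v) w = dotprod u w + dotprod v w.
Proof. by rewrite !dotprod3E !mxE; ring. Qed.

Lemma dotprodDr u v w : dotprod w (u + v) = dotprod w u + dotprod w v.
Proof. by rewrite !(dotprodC w) dotprodDl. Qed.

Lemma dotprodZl a u v : dotprod (a *: u) v = a * dotprod u v.
Proof. by rewrite !dotprod3E !mxE; ring. Qed.

Lemma dotprodZr a u v : dotprod u (a *: v) = a * dotprod u v.
Proof. by rewrite !(dotprodC u) dotprodZl. Qed.

Lemma dotprod0l u : dotprod 0 u = 0.
Proof. by rewrite -(scale0r (0 : 'cV_3)) dotprodZl mul0r. Qed.

Lemma dotprod_mulmx A u v : dotprod u (A *m v) = dotprod (A^T *m u) v.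
Proof. by rewrite /dotprod trmx_mul trmxK mulmxA. Qed.

Lemma dotprod_ge0 u : 0 <= dotprod u u.
Proof. by rewrite dotprodE sumr_ge0// => i _; rewrite -expr2 sqr_ge0. Qed.

Lemma sqr_coord_le_dotprod u i : (u i 0) ^+ 2 <= dotprod u u.
Proof.
rewrite dotprodE (bigD1 i)//= -expr2 lerDl sumr_ge0// => j _.
by rewrite -expr2 sqr_ge0.
Qed.

Lemma dotprod_eq0 u : (dotprod u u == 0) = (u == 0).
Proof.
apply/eqP/eqP => [u0|->]; last by rewrite dotprod0l.
apply/colP => i; rewrite mxE; apply/eqP; rewrite -sqrf_eq0 eq_le sqr_ge0 andbT.
by rewrite -u0 sqr_coord_le_dotprod.
Qed.

Lemma enorm_gt0 u : (0 < enorm u) = (u != 0).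
Proof. by rewrite sqrtr_gt0 lt0r dotprod_eq0 dotprod_ge0 andbT. Qed.

Lemma enorm_eq1 u : (enorm u = 1) <-> (dotprod u u = 1).
Proof.
split=> [u1|]; last by rewrite /enorm => ->; rewrite sqrtr1.
by rewrite -[LHS]sqr_sqrtr ?dotprod_ge0// -/(enorm u) u1 expr1n.
Qed.

Lemma crossprodvv u : crossprod u u = 0.
Proof. by apply/colP => i; rewrite !mxE mulrC subrr. Qed.

Lemma crossprodv0 u : crossprod u 0 = 0.
Proof. by apply/colP => i; rewrite !mxE !mulr0 subrr. Qed.

Lemma dotprod0r u : dotprod u 0 = 0.
Proof. by rewrite dotprodC dotprod0l. Qed.

Lemma crossprodZr a u v : crossprod u (a *: v) = a *: crossprod u v.
Proof. by apply/colP => i; rewrite !mxE; ring. Qed.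

Lemma posdef_ge0 J u : symmetric_posdef J -> 0 <= dotprod u (J *m u).
Proof.
by case=> _ Jpos; have [->|/Jpos/ltW//] := eqVneq u 0; rewrite dotprod0l.
Qed.

(** With [b] = <v, J v> and [c] = <u, J v>, the form at b u - c v equals b (b <u, J u> - c^2), the
    cross terms merging by symmetry of [J]. It is nonnegative, and b > 0 can be divided out. *)
Lemma posdef_Cauchy_Schwarz J u v : symmetric_posdef J ->
  dotprod u (J *m v) ^+ 2 <= dotprod u (J *m u) * dotprod v (J *m v).
Proof.
move=> hJ; have [Jsym Jpos] := hJ.
have [->|v0] := eqVneq v 0; first by rewrite mulmx0 !dotprod0r expr0n mulr0.
have b0 := Jpos v v0.
have Jvu : dotprod v (J *m u) = dotprod u (J *m v).
  by rewrite dotprod_mulmx Jsym dotprodC.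
pose b := dotprod v (J *m v); pose c := dotprod u (J *m v).
have := posdef_ge0 (b *: u + - c *: v) hJ.
rewrite mulmxDr -!scalemxAr !(dotprodDl, dotprodDr, dotprodZl, dotprodZr) Jvu.
rewrite -/b -/c (_ : _ + _ = b * (dotprod u (J *m u) * b - c ^+ 2)); last ring.
by rewrite pmulr_rge0// subr_ge0.
Qed.

(** By symmetry, a row [r] with r J = 0 also gives J r^T = 0, so the form would vanish at r^T. *)
Lemma posdef_unitmx J : symmetric_posdef J -> J \in unitmx.
Proof.
case=> Jsym Jpos; rewrite -row_free_unit -kermx_eq0; apply/rowV0P => r.
move=> /sub_kermxP rJ0; apply/eqP/negP => /negP r0.
have /Jpos : r^T != 0 by rewrite -trmx0 (inj_eq trmx_inj).
by rewrite -Jsym -trmx_mul rJ0 trmx0 dotprod0r ltxx.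
Qed.

(* [v i 0 = <v, J w>] with [J w] the [i]-th basis vector; apply Cauchy-Schwarz
   for the form of [J]. *)
Lemma posdef_coord_bound J : symmetric_posdef J ->
  exists2 K, 0 < K & forall v i, (v i 0) ^+ 2 <= K * dotprod v (J *m v).
Proof.
move=> hJ; pose w i : 'cV[R]_3 := invmx J *m delta_mx i 0.
(* The sum dominates the Cauchy-Schwarz constant of each coordinate; the 1 makes it positive. *)
exists (1 + \sum_i dotprod (w i) (J *m w i)).
  by rewrite ltr_pwDl// sumr_ge0// => i _; exact: posdef_ge0.
move=> v i.
have Jw : J *m w i = delta_mx i 0 by rewrite mulKVmx// posdef_unitmx.
have -> : v i 0 = dotprod v (J *m w i).
  rewrite Jw dotprodE (bigD1 i)//= mxE !eqxx mulr1 big1 ?addr0// => j ji.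
  by rewrite mxE (negPf ji) mulr0.
apply: le_trans (posdef_Cauchy_Schwarz v (w i) hJ) _.
rewrite mulrC ler_wpM2r ?posdef_ge0// (bigD1 i)//= addrCA lerDl addr_ge0//.
by apply: sumr_ge0 => j _; exact: posdef_ge0.
Qed.

End DotCross.

(** * Derivatives and limits of vector-valued maps, and conservation along solutions *)

Section Calculus.
Variable R : realType.

(** Projecting commutes with forming the difference quotient, and the projection is continuous. *)
Lemma is_derive_fst (U V : normedModType R) (x : R -> U * V) (t : R) dx :
  is_derive t 1 x dx -> is_derive t 1 (fun s => (x s).1) dx.1.
Proof.
move=> [dxt <-].
have h : (fun h => h^-1 *: (((fun s => (x s).1) \o shift t) (h *: 1) - (x t).1))
    @ 0^' --> ('D_1 x t).1.
  exact: cvg_comp dxt cvg_fst.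
by split; [apply/cvg_ex; eexists; exact: h | exact: cvg_lim h].
Qed.

Lemma is_derive_snd (U V : normedModType R) (x : R -> U * V) (t : R) dx :
  is_derive t 1 x dx -> is_derive t 1 (fun s => (x s).2) dx.2.
Proof.
move=> [dxt <-].
have h : (fun h => h^-1 *: (((fun s => (x s).2) \o shift t) (h *: 1) - (x t).2))
    @ 0^' --> ('D_1 x t).2.
  exact: cvg_comp dxt cvg_snd.
by split; [apply/cvg_ex; eexists; exact: h | exact: cvg_lim h].
Qed.

Lemma is_derive_mxP (V : normedModType R) p q (M : V -> 'M[R]_(p, q)) t v dM :
  is_derive t v M dM <->
  forall i j, is_derive t v (fun s => M s i j) (dM i j).
Proof.
split=> [[dMt <-] i j|h].
  split; first exact: (derivable_mxP _ _ _).1.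
  by rewrite derive_mx// mxE.
have dMt : derivable M t v by apply/derivable_mxP => i j; have [] := h i j.
split=> //; rewrite derive_mx//; apply/matrixP => i j.
by rewrite mxE; have [] := h i j.
Qed.

Lemma is_derive_mulmx (V : normedModType R) p q r (A : 'M[R]_(p, q))
    (M : V -> 'M[R]_(q, r)) t v dM :
  is_derive t v M dM -> is_derive t v (fun s => A *m M s) (A *m dM).
Proof.
move=> /is_derive_mxP h; apply/is_derive_mxP => i j; rewrite mxE.
rewrite [X in is_derive _ _ X _](_ : _ = \sum_k (A i k \*: (fun s => M s k j))).
  by apply: is_derive_sum => k; have hk := h k j; exact: is_deriveZ.
by apply/funext => s; rewrite mxE fct_sumE.
Qed.

Lemma is_derive_dotprod (V : normedModType R) (f g : V -> 'cV[R]_3) t v df dg :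
  is_derive t v f df -> is_derive t v g dg ->
  is_derive t v (fun s => dotprod (f s) (g s))
    (dotprod df (g t) + dotprod (f t) dg).
Proof.
move=> /is_derive_mxP hf /is_derive_mxP hg.
rewrite [X in is_derive _ _ X _](_ : _ =
    \sum_i ((fun s => f s i 0) * (fun s => g s i 0))); last first.
  by apply/funext => s; rewrite dotprodE fct_sumE.
rewrite !dotprodE -big_split/=; apply: is_derive_sum => i.
have [hfi hgi] := (hf i 0, hg i 0).
by apply: is_derive_eq; rewrite addrC [X in _ + X = _]mulrC.
Qed.

Lemma continuous_dotprod (T : topologicalType) (f g : T -> 'cV[R]_3) :
  continuous f -> continuous g -> continuous (fun x => dotprod (f x) (g x)).
Proof.
move=> cf cg x; under eq_fun do rewrite dotprod3E.
have c (h : T -> 'cV[R]_3) i : continuous h -> h y i 0 @[y --> x] --> h x i 0.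
  move=> ch; exact: (@continuous_comp _ _ _ h (fun M : 'cV[R]_3 => M i 0) x
    (ch x) (@coord_continuous _ _ _ _ _ _)).
by rewrite /continuous_at; do ![apply: cvgD | apply: cvgM]; exact: c.
Qed.

(** Balls of matrices are entrywise, and finitely many conditions that each hold eventually hold
    together. *)
Lemma cvg_mx (T : Type) (F : set_system T) (FF : Filter F) p q
    (M : T -> 'M[R]_(p, q)) (N : 'M[R]_(p, q)) :
  (forall i j, M x i j @[x --> F] --> N i j) -> M x @[x --> F] --> N.
Proof.
move=> MN; apply/cvg_ballP => e e0; near=> x; split=> //.
near: x; apply: filter_forall => i; apply: filter_forall => j.
by have /cvg_ballP/(_ e e0) := MN i j.
Unshelve. all: by end_near. Qed.

Lemma continuous_mulmx p q r (A : 'M[R]_(p, q)) :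
  continuous (fun M : 'M[R]_(q, r) => A *m M : 'M[R]_(p, r)).
Proof.
move=> M0; apply: (cvg_mx (nbhs_filter M0)) => i j; rewrite mxE.
under eq_fun do rewrite mxE.
apply: cvg_big => [|k _]; first exact: add_continuous.
by apply: cvgMl_tmp; exact: coord_continuous.
Qed.

(** Mean value theorem on [0, t]: the derivative is needed only inside the interval, and continuity
    up to the endpoint 0 does the rest. *)
Lemma solution_first_integral (V : normedModType R) (E : V -> V -> Prop)
    (F : V -> R) (T : \bar R) (x : R -> V) :
  continuous F -> solution E T x ->
  (forall (t : R) dx, is_derive t 1 x dx -> E (x t) dx ->
    is_derive t 1 (F \o x) 0) ->
  forall t, 0 <= t -> (t%:E < T)%E -> F (x t) = F (x 0).
Proof.
move=> cF [cx dx] dF t t0 tT.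
have [||c _] := @MVT_segment R (F \o x) (fun=> 0) 0 t t0.
- move=> s; rewrite in_itv/= => /andP[s0 st].
  have /dx[//|dxs Exs] : (s%:E < T)%E by rewrite (lt_trans _ tT)// lte_fin.
  exact: dF (derivableP dxs) Exs.
- apply: within_continuous_comp; first by move=> y _; exact: cF.
  apply: continuous_subspaceW cx => s /=; rewrite in_itv/= => /andP[-> st].
  by split=> //; rewrite (le_lt_trans _ tT)// lee_fin.
by rewrite mul0r => /eqP; rewrite subr_eq0 => /eqP.
Qed.

End Calculus.

(** * The two first integrals of the pendulum and the coercivity of the energy *)

Section Pendulum.
Variables (R : realType) (J : 'M[R]_3) (m g : R) (rho : 'cV[R]_3).
Hypotheses (hJ : symmetric_posdef J) (hm : 0 < m) (hg : 0 < g).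
Hypothesis hrho : rho != 0.

Let Gh := (enorm rho)^-1 *: rho.
Let k := m * g * enorm rho.

Let k_gt0 : 0 < k.
Proof. by rewrite !mulr_gt0// enorm_gt0. Qed.

(* On the sphere this is twice the mechanical energy, shifted to vanish at the
   hanging equilibrium: there [k / 2 * |G - Gh|^2 = m g (|rho| - <rho, G>)]. *)
Definition pendulum_energy (x : 'cV[R]_3 * 'cV[R]_3) : R :=
  dotprod x.2 (J *m x.2) + k * dotprod (x.1 - Gh) (x.1 - Gh).

Lemma pendulum_energy_continuous : continuous pendulum_energy.
Proof.
have c1 : continuous (fun x : 'cV[R]_3 * 'cV[R]_3 => x.1 - Gh).
  by move=> x; apply: cvgB; [exact: cvg_fst | exact: cvg_cst].
have c2 : continuous (fun x : 'cV[R]_3 * 'cV[R]_3 => x.2).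
  by move=> x; exact: cvg_snd.
have cJ : continuous (fun x : 'cV[R]_3 * 'cV[R]_3 => J *m x.2).
  by move=> x; apply: (continuous_comp (c2 x)); exact: continuous_mulmx.
move=> x; apply: cvgD; first exact: (continuous_dotprod c2 cJ).
by apply: cvgMl_tmp; exact: (continuous_dotprod c1 c1).
Qed.

Lemma pendulum_energy_hanging : pendulum_energy (hanging_equilibrium rho) = 0.
Proof. by rewrite /pendulum_energy/= subrr !dotprod0l mulr0 addr0. Qed.

Lemma pendulum_energy_bound : exists2 K, 0 < K & forall x i,
  ((x.1 - Gh) i 0) ^+ 2 <= K * pendulum_energy x /\
  (x.2 i 0) ^+ 2 <= K * pendulum_energy x.
Proof.
have [K K0 hK] := posdef_coord_bound hJ.
exists (K + k^-1); first by rewrite addr_gt0// invr_gt0.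
move=> x i; rewrite /pendulum_energy.
(* Both terms of the energy are nonnegative, so each is at most the energy. [K] serves the angular
   velocity, [k^-1] undoes the weight of the direction term, and their sum serves both. *)
have Jx := posdef_ge0 x.2 hJ.
have kG : 0 <= k * dotprod (x.1 - Gh) (x.1 - Gh).
  by rewrite mulr_ge0 ?dotprod_ge0// ltW.
have [K0' k0'] : 0 <= K /\ 0 <= k^-1 by split; rewrite ltW ?invr_gt0.
split.
- apply: le_trans (sqr_coord_le_dotprod _ i) _.
  rewrite -[leLHS](mulKf (lt0r_neq0 k_gt0)).
  by rewrite ler_pM// ?lerDr ?lerDl.
- apply: le_trans (hK _ i) _.
  by rewrite ler_pM// lerDl.
Qed.

(** The gyroscopic term does no work, since J w x w is orthogonal to w, and <G, G x w> = 0. The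
    remaining terms 2 m g <w, rho x G> and -2 m g <rho, G x w> cancel because the triple product is
    cyclic. *)
Lemma pendulum_energy_derive (x : R -> 'cV[R]_3 * 'cV[R]_3) (t : R) dx :
  is_derive t 1 x dx -> pendulum_dynamics J m g rho (x t) dx ->
  is_derive t 1 (pendulum_energy \o x) 0.
Proof.
move=> hx; case: dx hx => dG dw hx; case Ext : (x t) => [G w] /= [Edw EdG].
have hG := is_derive_fst hx.
have hw := is_derive_snd hx.
have hGG : is_derive t 1 (fun s => (x s).1 - Gh) dG.
  by rewrite -[X in is_derive _ _ _ X](subr0 dG); exact: is_deriveB.
have h1 := is_derive_dotprod hw (is_derive_mulmx J hw).
have h2 := is_derive_dotprod hGG hGG.
have h3 := is_deriveZ k h2.
apply: is_derive_eq (is_deriveD h1 h3) _.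
(* The factor |rho| in [k] cancels the normalisation of [Gh]. *)
have kGh : k *: Gh = (m * g) *: rho.
  by rewrite scalerA mulfK// gt_eqF// enorm_gt0.
(* The equation of motion gives only [J *m dw], so symmetry is used to move [J] onto [dw] in the
   other term too. *)
rewrite Ext /= dotprod_mulmx hJ.1 Edw EdG (dotprodC (crossprod G w)).
rewrite [X in _ + X](_ : _ = 2%:R * dotprod (k *: G - k *: Gh) (crossprod G w)).
  (* Any vector [p] can stand for [J *m w], since p x w is orthogonal to w. *)
  rewrite kGh; move: (J *m w) => p; rewrite !dotprod3E.
  by rewrite !(crossprod3E, mxE); ring.
by rewrite -scalerBr dotprodZl -[LHS]/(k * _); ring.
Qed.

(** G x w is orthogonal to G; this is what keeps trajectories on the sphere. *)
Lemma pendulum_sphere_derive (x : R -> 'cV[R]_3 * 'cV[R]_3) (t : R) dx :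
  is_derive t 1 x dx -> pendulum_dynamics J m g rho (x t) dx ->
  is_derive t 1 ((fun y => dotprod y.1 y.1) \o x) 0.
Proof.
move=> hx; case: dx hx => dG dw hx; case Ext : (x t) => [G w] /= [_ EdG].
have hG := is_derive_fst hx.
apply: is_derive_eq (is_derive_dotprod hG hG) _.
by rewrite Ext /= EdG !dotprod3E !crossprod3E; ring.
Qed.

End Pendulum.

(** * Equilibrium property and Lyapunov stability *)

Unset Implicit Arguments.
Set Strict Implicit.

Theorem proposition12 (R : realType) (J : 'M[R]_3) (m g : R) (rho : 'cV[R]_3)
    (hJ : symmetric_posdef J) (hm : 0 < m) (hg : 0 < g) (hrho : rho != 0) :
  equilibrium (@pendulum_phase_space R) (pendulum_dynamics J m g rho)
    (hanging_equilibrium rho) /\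
  lyapunov_stable (@pendulum_phase_space R) (pendulum_dynamics J m g rho)
    (hanging_equilibrium rho).
Proof.
split.
  split; last first.
    split; rewrite ?mulmx0 !crossprodv0//.
    by rewrite crossprodZr crossprodvv !scaler0 addr0.
  split=> //; apply/enorm_eq1.
  rewrite dotprodZl dotprodZr -[dotprod rho rho]sqr_sqrtr ?dotprod_ge0//.
  by rewrite -/(enorm rho) mulrA -expr2 -exprMn mulVf ?expr1n// gt_eqF// enorm_gt0.
move=> e e0.
have [K K0 hK] := pendulum_energy_bound hJ hm hg hrho.
(* At energy below [eta] the coercivity bound puts every squared coordinate of the deviation below
   [e ^+ 2]. *)
pose eta := e ^+ 2 / K.
have eta0 : 0 < eta by rewrite divr_gt0// exprn_gt0.
have : \forall x \near hanging_equilibrium rho, pendulum_energy J m g rho x < eta.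
  apply: (cvgr_lt _ (@pendulum_energy_continuous _ _ _ _ _ _)).
  by rewrite pendulum_energy_hanging.
move=> /nbhs_ballP[d /= d0 hd]; exists d => // T x sol [[x0S _] x0d] t t0 tT.
(* The choice of [d] bounds the energy at time 0, and conservation carries the bound to time [t]. *)
have Et : pendulum_energy J m g rho (x t) < eta.
  rewrite (solution_first_integral _ sol _ t0 tT); first exact: hd.
  - exact: pendulum_energy_continuous.
  - exact: pendulum_energy_derive.
have KE : K * pendulum_energy J m g rho (x t) < e ^+ 2 by rewrite mulrC -ltr_pdivlMr.
have abs_lt (a : R) : a ^+ 2 <= K * pendulum_energy J m g rho (x t) -> `|a| < e.
  move=> /le_lt_trans/(_ KE) ae.
  by rewrite -ltr_sqr ?nnegrE ?(ltW e0)// real_normK ?num_real.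
split.
  split=> //; apply/enorm_eq1; rewrite -((enorm_eq1 _).1 x0S).
  apply: (solution_first_integral (F := fun y => dotprod y.1 y.1) _ sol _ t0 tT).
  - apply: continuous_dotprod => y; exact: cvg_fst.
  - exact: pendulum_sphere_derive.
(* The ball of the product space is a condition on each coordinate of each component. *)
split; split=> // i j; rewrite (ord1 j) -ball_normE/= distrC; apply: abs_lt.
- by have [+ _] := hK (x t) i; rewrite !mxE.
- by have [_ +] := hK (x t) i; rewrite !mxE subr0.
Qed.
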